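(* Let $D$ be a positive integer that is not a perfect square, $\Gamma=SL_2(\mathbb Z)$, with cusp $\infty$ (scaling matrix $I$) and hyperbolic fixed pair $\eta=(-\sqrt D,\sqrt D)$ with scaling matrix $\sigma_\eta=\frac{1}{\sqrt{2\sqrt D}}\begin{pmatrix}\sqrt D&-\sqrt D\\1&1\end{pmatrix}$, and notation as in the context. Then for all $m,n\in\mathbb Z$ and every nonzero integer $N$, $$S_{\eta\infty}\!\left(m,n;\frac{-N}{2\sqrt D}\right)=-\psi_D(m,n;N)+\frac12\sum_{(e,g)\in R^*_D(N)}\mathbf e\!\left(\frac{m}{\ell_\eta}\log\left|\frac{e+g\sqrt D}{e-g\sqrt D}\right|-\frac{n\,e\,g^{-1}}{N}\right),$$ where $g^{-1}$ denotes the inverse of $g$ modulo $N$; if $g=0$ then $N=1$ and one may set $g^{-1}=0$.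
   Context: $\mathbf e(z)=e^{2\pi i z}$. Let $(a_0,c_0)$ be the positive integer solution of $a^2-Dc^2=1$ with $a_0>1$ minimal, $\varepsilon_D=a_0+\sqrt D c_0$, and $\ell_\eta=2\log\varepsilon_D$. The stabilizer $\Gamma_\eta$ of $\pm\sqrt D$ in $\Gamma$ satisfies $\sigma_\eta^{-1}\Gamma_\eta\sigma_\eta=\{\pm\mathrm{diag}(\varepsilon_D^j,\varepsilon_D^{-j}):j\in\mathbb Z\}$; $\Gamma_\infty$ is the stabilizer of $\infty$. For real $C$ define $$S_{\eta\infty}(m,n;C)=\sum\mathbf e\!\left(\frac m{\ell_\eta}\log\left|\frac ac\right|+n\Big(\frac b{2a}+\frac d{2c}\Big)\right),$$ summed over double cosets $\gamma\in\Gamma_\eta\backslash\Gamma/\Gamma_\infty$ with $\begin{pmatrix}a&b\\c&d\end{pmatrix}=\sigma_\eta^{-1}\gamma$ and $ac=C$ (an empty sum being $0$). Write $\frac{a_0+1}{c_0}=\frac{u_+}{v_+}$ and $\frac{a_0-1}{c_0}=\frac{u_-}{v_-}$ in lowest terms, $D_+=u_+^2-Dv_+^2$, $D_-=u_-^2-Dv_-^2$. Define $\psi_D(m,n;N)=(-1)^{m+c_0n}$ if $N=D_+$ or $N=D_-$, and $\psi_D(m,n;N)=0$ otherwise. Define $R^*_D(N)=\{(e,g)\in\mathbb Z^2:\gcd(e,g)=1,\ e^2-Dg^2=N,\ e^2+Dg^2\leqslant a_0|N|\}$. *)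

(* Defs.v *)
From HB Require Import structures.
From mathcomp Require Import all_boot all_order all_algebra.
From mathcomp Require Import all_classical all_reals all_analysis.
From mathcomp Require Import complex.

Set Implicit Arguments.
Unset Strict Implicit.
Unset Printing Implicit Defensive.

Import Order.TTheory GRing.Theory Num.Theory.
Import numFieldNormedType.Exports.

Local Open Scope classical_set_scope.
Local Open Scope ring_scope.

Definition mx2 (T : Type) (a b c d : T) : 'M[T]_2 :=
  \matrix_(i < 2, j < 2)
    if i == 0 then (if j == 0 then a else b) else (if j == 0 then c else d).

Definition cexp (R : realType) (z : R[i]) : R[i] :=
  (expR (complex.Re z))%:C%C *
    Complex (cos (complex.Im z)) (sin (complex.Im z)).

(* [e^(2 pi i x)] *)
Definition ee (R : realType) (x : R) : R[i] :=
  cexp (2 * (pi : R)%:C%C * Complex 0 1 * x%:C%C).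

(* The existence of such a pair is Pell's theorem; minimising [a0] also
   minimises [c0]. *)
Definition pell_fundamental (D a0 c0 : nat) : Prop :=
  [/\ (1 < a0)%N, (0 < c0)%N, a0%:Z ^+ 2 - D%:Z * c0%:Z ^+ 2 = 1 &
      forall a c : nat, (1 < a)%N -> (0 < c)%N ->
        a%:Z ^+ 2 - D%:Z * c%:Z ^+ 2 = 1 -> (a0 <= a)%N].

Definition epsD (R : realType) (D a0 c0 : nat) : R :=
  a0%:R + Num.sqrt D%:R * c0%:R.

Definition ell_eta (R : realType) (D a0 c0 : nat) : R :=
  2 * ln (epsD R D a0 c0).

Definition sigma_eta (R : realType) (D : nat) : 'M[R]_2 :=
  let s : R := Num.sqrt D%:R in
  (Num.sqrt (2 * s))^-1 *: mx2 s (- s) 1 1.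

Definition Gamma : set 'M[int]_2 := [set g | \det g = 1].

(* Linear fractional action on the projective line; [None] is infinity. *)
Definition mobius (R : realType) (g : 'M[R]_2) (z : option R) : option R :=
  if z is Some x then
    if g 1 0 * x + g 1 1 == 0 then None
    else Some ((g 0 0 * x + g 0 1) / (g 1 0 * x + g 1 1))
  else if g 1 0 == 0 then None else Some (g 0 0 / g 1 0).

Definition stab (R : realType) (z : option R) : set 'M[int]_2 :=
  [set g | Gamma g /\ mobius (map_mx intr g) z = z].

Definition Gamma_infty (R : realType) : set 'M[int]_2 := stab (None : option R).

(* Both points of the pair are fixed; they are not allowed to be exchanged. *)
Definition Gamma_eta (R : realType) (D : nat) : set 'M[int]_2 :=
  let s : R := Num.sqrt D%:R in stab (Some (- s)) `&` stab (Some s).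

Definition double_coset (R : realType) (D : nat) (g : 'M[int]_2) :
    set 'M[int]_2 :=
  [set h | exists g1 g2, [/\ Gamma_eta R D g1, Gamma_infty R g2 &
                             h = g1 *m g *m g2]].

Definition scaled (R : realType) (D : nat) (g : 'M[int]_2) : 'M[R]_2 :=
  invmx (sigma_eta R D) *m map_mx intr g.

Definition S_summand (R : realType) (D a0 c0 : nat) (m n : int)
    (g : 'M[int]_2) : R[i] :=
  let M := scaled R D g in
  let a := M 0 0 in let b := M 0 1 in let c := M 1 0 in let d := M 1 1 in
  ee (m%:~R / ell_eta R D a0 c0 * ln `|a / c|
      + n%:~R * (b / (2 * a) + d / (2 * c))).

(* The index set consists of the double cosets themselves, as sets of matrices.
   The product [a c] and the summand depend only on the double coset, so the
   summand is evaluated at a chosen representative [xget 1%:M X] of [X].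
   Only finitely many double cosets have a given value of [a c]. *)
Definition S_eta_infty (R : realType) (D a0 c0 : nat) (m n : int) (C : R) :
    R[i] :=
  \sum_(X \in [set double_coset R D g | g in
                [set g | Gamma g /\ scaled R D g 0 0 * scaled R D g 1 0 = C]])
    S_summand R D a0 c0 m n (xget 1%:M X).

(* [numq] and [denq] are the numerator and the denominator in lowest terms. *)
Definition D_plus (D a0 c0 : nat) : int :=
  let q : rat := (a0%:R + 1) / c0%:R in numq q ^+ 2 - D%:Z * denq q ^+ 2.

Definition D_minus (D a0 c0 : nat) : int :=
  let q : rat := (a0%:R - 1) / c0%:R in numq q ^+ 2 - D%:Z * denq q ^+ 2.

Definition psiD (R : realType) (D a0 c0 : nat) (m n N : int) : R[i] :=
  if (N == D_plus D a0 c0) || (N == D_minus D a0 c0)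
  then (-1) ^ (m + c0%:Z * n) else 0.

Definition RstarD (D a0 : nat) (N : int) : set (int * int) :=
  [set eg | [/\ coprimez eg.1 eg.2,
                eg.1 ^+ 2 - D%:Z * eg.2 ^+ 2 = N &
                eg.1 ^+ 2 + D%:Z * eg.2 ^+ 2 <= a0%:Z * `|N|]].

(* A Bezout coefficient: [u * g + v * N = gcdz g N] with [(u, v) = egcdz g N],
   so [u] is an inverse of [g] modulo [N] whenever [g] and [N] are coprime. *)
Definition invmodz (N g : int) : int :=
  if g == 0 then 0 else (egcdz g N).1.

Definition R_summand (R : realType) (D a0 c0 : nat) (m n N : int)
    (eg : int * int) : R[i] :=
  let s : R := Num.sqrt D%:R in
  let e : R := eg.1%:~R in let g : R := eg.2%:~R in
  ee (m%:~R / ell_eta R D a0 c0 * ln `|(e + g * s) / (e - g * s)|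
      - n%:~R * e * (invmodz N eg.2)%:~R / N%:~R).

(* Main.v *)
Require Import Defs.
From HB Require Import structures.
From mathcomp Require Import all_boot all_order all_algebra.
From mathcomp Require Import all_classical all_reals all_analysis.
From mathcomp Require Import complex ring lra zify.
Set Implicit Arguments.
Unset Strict Implicit.
Unset Printing Implicit Defensive.
Import Order.TTheory GRing.Theory Num.Theory.
Import numFieldNormedType.Exports.
Local Open Scope classical_set_scope.
Local Open Scope ring_scope.

(* The first column [(e, g)] of [gamma], read as [x = e + g sqrt D] with
   conjugate [x'], determines everything: [a c = - x x' / (2 sqrt D)],
   [|a / c| = |x / x'|], and [b / (2a) + d / (2c)] is [- e g^-1 / N] modulo 1.
   Double cosets thus correspond to primitive [x] of norm [N] up to units of
   norm 1, and these units are [+- eps^j].  The inequality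
   [e^2 + D g^2 <= a0 |N|] says [eps^-1 <= |x / x'| <= eps]; multiplication by
   [eps] scales the ratio by [eps^2], so the half-open range
   [eps^-1 < |x / x'| <= eps] with [x > 0] is a fundamental domain.  The closed
   range counts each double coset twice, because of the sign, and in addition
   contains the points with [|x / x'| = eps^-1].  These exist only for
   [N = D_+] or [N = D_-], where they are [+- (u, - v)] and each contributes
   [(-1)^(m + c0 n)], so that half of their sum is [psi_D]. *)

(** * Quadratic integers and units of norm one *)

(* A pair [(e, g)] stands for [e + g sqrt d]. *)
Definition qnorm (d : int) (x : int * int) : int := x.1 ^+ 2 - d * x.2 ^+ 2.

Definition qsize (d : int) (x : int * int) : int := x.1 ^+ 2 + d * x.2 ^+ 2.

Definition qmul (d : int) (u x : int * int) : int * int :=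
  (u.1 * x.1 + d * u.2 * x.2, u.2 * x.1 + u.1 * x.2).

Definition qconj (x : int * int) : int * int := (x.1, - x.2).

Definition qassoc (d : int) (x y : int * int) : Prop :=
  exists2 u, qnorm d u = 1 & y = qmul d u x.

Lemma qmulA d u v x : qmul d u (qmul d v x) = qmul d (qmul d u v) x.
Proof. by congr pair => /=; ring. Qed.

Lemma qmul1 d x : qmul d (1, 0) x = x.
Proof. by case: x => e g; congr pair => /=; ring. Qed.

Lemma qmulN1 d x : qmul d (-1, 0) x = - x.
Proof. by case: x => e g; congr pair => /=; ring. Qed.

Lemma qnormM d u x : qnorm d (qmul d u x) = qnorm d u * qnorm d x.
Proof. by rewrite /qnorm /=; ring. Qed.

Lemma qnorm_conj d x : qnorm d (qconj x) = qnorm d x.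
Proof. by rewrite /qnorm /=; ring. Qed.

Lemma qmul_conj d u : qmul d (qconj u) u = (qnorm d u, 0).
Proof. by congr pair; rewrite /qnorm /=; ring. Qed.

Lemma qassoc_refl d x : qassoc d x x.
Proof. by exists (1, 0); rewrite ?qmul1 // /qnorm /=; ring. Qed.

Lemma qassoc_sym d x y : qassoc d x y -> qassoc d y x.
Proof.
case=> u u1 ->; exists (qconj u); first by rewrite qnorm_conj.
by rewrite qmulA qmul_conj u1 qmul1.
Qed.

Lemma qassoc_trans d x y z : qassoc d x y -> qassoc d y z -> qassoc d x z.
Proof.
case=> u u1 -> [v v1 ->]; exists (qmul d v u); last by rewrite qmulA.
by rewrite qnormM u1 v1 mulr1.
Qed.

Lemma qassocN d x : qassoc d x (- x).
Proof. by exists (-1, 0); rewrite ?qmulN1 // /qnorm /=; ring. Qed.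

Lemma qassoc_norm d x y : qassoc d x y -> qnorm d y = qnorm d x.
Proof. by case=> u u1 ->; rewrite qnormM u1 mul1r. Qed.

Lemma coprimez_exP (e g : int) :
  coprimez e g <-> exists u v, u * e + v * g = 1.
Proof.
by split=> [/coprimezP[[u v] /= <-]|[u [v h]]];
  [exists u, v|apply/coprimezP; exists (u, v)].
Qed.

(** Multiplication by a unit of norm [1] is a linear map of determinant [1] on pairs; its inverse
    transports the Bezout coefficients. *)
Lemma qassoc_coprime d x y :
  qassoc d x y -> coprimez x.1 x.2 -> coprimez y.1 y.2.
Proof.
case=> [[p r]] u1 -> /coprimez_exP[u [v uv]]; apply/coprimez_exP.
exists (u * p - v * r), (v * p - u * d * r).
by rewrite -uv -[RHS]mul1r -u1 /qnorm /=; ring.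
Qed.

(** Modulo [g] the norm is [e ^+ 2]. The witnesses come from
    [1 - (u * e) ^+ 2 = v * g * (1 + u * e)]. *)
Lemma coprimez_qnorm d x : coprimez x.1 x.2 -> coprimez x.2 (qnorm d x).
Proof.
case: x => e g /= /coprimez_exP[u [v uv]]; apply/coprimez_exP.
exists (v * (1 + u * e) + u ^+ 2 * d * g), (u ^+ 2).
by rewrite -[RHS]mul1r -{1}uv -uv /qnorm /=; ring.
Qed.

(** * Reduction of pairs by the fundamental unit, in integers *)

Section Fundamental.

Variables (d a c : int).
Hypotheses (d_gt0 : 0 < d) (a_gt1 : 1 < a) (c_gt0 : 0 < c).
Hypothesis pell : a ^+ 2 - d * c ^+ 2 = 1.

Lemma qsize_norm x : qsize d x ^+ 2 = qnorm d x ^+ 2 + 4 * d * (x.1 * x.2) ^+ 2.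
Proof. by rewrite /qsize /qnorm; ring. Qed.

Lemma qsize_mul u x : qnorm d u = 1 ->
  qsize d (qmul d u x)
    = qsize d x + 2 * d * u.2 * (u.2 * qsize d x + 2 * u.1 * (x.1 * x.2)).
Proof.
move=> u1; have u1E : u.1 ^+ 2 = 1 + d * u.2 ^+ 2 by move: u1; rewrite /qnorm;
  lra.
transitivity ((u.1 ^+ 2 + d * u.2 ^+ 2) * qsize d x
              + 4 * u.1 * u.2 * d * (x.1 * x.2)).
  by rewrite /qsize /=; ring.
by rewrite u1E; ring.
Qed.

Lemma qsize_ge0 x : 0 <= qsize d x.
Proof. by apply: addr_ge0; first exact: sqr_ge0; apply: mulr_ge0;
  [exact: ltW|exact: sqr_ge0]. Qed.

Lemma qsize_minimal x : exists2 y, qassoc d x y &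
  forall z, qassoc d x z -> qsize d y <= qsize d z.
Proof.
pose P k := `[< exists2 y, qassoc d x y & `|qsize d y|%N = k >].
have exP : exists k, P k.
  by exists `|qsize d x|%N; apply/asboolP; exists x => //; exact: qassoc_refl.
case: (ex_minnP exP) => k /asboolP[y xy <-] kmin; exists y => // z xz.
have := kmin `|qsize d z|%N; rewrite -lez_nat !gez0_abs ?qsize_ge0//.
by apply; apply/asboolP; exists z.
Qed.

(* Multiplying a minimal element by the fundamental unit or its conjugate cannot
   decrease [qsize], which bounds [|e g|] and hence [qsize] itself. *)
Lemma reduced_exists x : exists2 y, qassoc d x y &
  qsize d y <= a * `|qnorm d y|.
Proof.
case: (qsize_minimal x) => y xy ymin; exists y => //.
have bound u : qnorm d u = 1 ->
    0 <= d * (u.2 * (u.2 * qsize d y + 2 * u.1 * (y.1 * y.2))).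
  move=> u1; have := ymin (qmul d u y).
  rewrite qsize_mul// => /(_ (qassoc_trans xy (ex_intro2 _ _ u u1 erefl))).
  by lra.
have := bound (a, - c); rewrite (qnorm_conj d (a, c)) => /(_ pell).
have := bound (a, c) pell.
rewrite !(pmulr_rge0 _ d_gt0) /= mulNr -mulrN !(pmulr_rge0 _ c_gt0) => h1 h2.
set Q := qsize d y in h1 h2 *; set P := y.1 * y.2 in h1 h2 *.
have q0 : 0 <= Q := qsize_ge0 y.
have QN : Q ^+ 2 = qnorm d y ^+ 2 + 4 * d * P ^+ 2 := qsize_norm y.
(* The product of [h1] and [h2] is this difference of squares. With [d * c ^+ 2 = a ^+ 2 - 1] it
   becomes [Q ^+ 2 <= a ^+ 2 * (Q ^+ 2 - 4 * d * P ^+ 2)], whose bracket is the squared norm. *)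
have h3 : (2 * a * P) ^+ 2 <= (c * Q) ^+ 2.
  by rewrite -subr_ge0; have := mulr_ge0 h1 h2; lra.
rewrite -ler_sqr ?nnegrE ?mulr_ge0 ?normr_ge0 ?(ltW (lt_trans ltr01 a_gt1))//.
rewrite exprMn real_normK ?num_real//.
have := ler_wpM2l (ltW d_gt0) h3.
have -> : qnorm d y ^+ 2 = Q ^+ 2 - 4 * d * P ^+ 2 by rewrite QN; ring.
have : d * c ^+ 2 * Q ^+ 2 = (a ^+ 2 - 1) * Q ^+ 2 by rewrite -pell; ring.
by lra.
Qed.

(** Inserting the size into [qsize_norm] gives [4 * d * P ^+ 2 = (a ^+ 2 - 1) * M ^+ 2 = d * c ^+ 2
    * M ^+ 2]; the sign of [P] picks the root. *)
Lemma qsize_boundary y : qsize d y = a * `|qnorm d y| -> y.1 * y.2 < 0 ->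
  2 * (y.1 * y.2) = - (c * `|qnorm d y|).
Proof.
set P := y.1 * y.2; set M := `|_| => QE P_lt0.
have M2 : M ^+ 2 = qnorm d y ^+ 2 by rewrite real_normK ?num_real.
have : d * (2 * P) ^+ 2 == d * (c * M) ^+ 2.
  have := qsize_norm y; rewrite QE -M2 -/P exprMn => E.
  have -> : d * (c * M) ^+ 2 = (d * c ^+ 2) * M ^+ 2 by ring.
  have -> : d * c ^+ 2 = a ^+ 2 - 1 by rewrite -pell; ring.
  by rewrite mulrBl E; apply/eqP; ring.
rewrite (inj_eq (mulfI (lt0r_neq0 d_gt0))) eqf_sqr => /orP[]/eqP // E.
have : 0 <= 2 * P by rewrite E mulr_ge0 ?normr_ge0 ?ltW.
by lra.
Qed.

(* The points with [|x / x'| = eps^-1]. *)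
Definition boundary (y : int * int) : Prop :=
  qsize d y = a * `|qnorm d y| /\ y.1 * y.2 < 0.

Lemma boundaryN y : boundary (- y) <-> boundary y.
Proof. by rewrite /boundary /qsize /qnorm /= mulrNN !sqrrN. Qed.

(** The fundamental unit moves the end [eps^-1] of the range of [|x / x'|] to the end [eps]: the
    product of the coordinates passes from [- c * M / 2] to [c * M / 2], where [M] is the absolute
    norm. *)
Lemma boundary_mul y : boundary y ->
  qsize d (qmul d (a, c) y) = a * `|qnorm d y| /\ ~ boundary (qmul d (a, c) y).
Proof.
case=> QE Plt0; have PE := qsize_boundary QE Plt0.
have QE' : qsize d (qmul d (a, c) y) = a * `|qnorm d y|.
  rewrite qsize_mul//= QE -!mulrA; set M := `|_| in PE *.
  have -> : 2 * (a * (y.1 * y.2)) = a * (2 * (y.1 * y.2)) by ring.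
  by rewrite PE; ring.
split=> // -[_]; apply/negP; rewrite -leNgt.
have -> : (qmul d (a, c) y).1 * (qmul d (a, c) y).2 =
    a * c * qsize d y + (a ^+ 2 + d * c ^+ 2) * (y.1 * y.2).
  by rewrite /qsize /=; ring.
have M0 := normr_ge0 (qnorm d y); rewrite QE; set M := `|_| in PE M0 *.
rewrite -(pmulr_rge0 _ (ltr0Sn int 1)) mulrDr.
have -> : 2 * ((a ^+ 2 + d * c ^+ 2) * (y.1 * y.2)) =
   (a ^+ 2 + d * c ^+ 2) * (2 * (y.1 * y.2)) by ring.
rewrite PE; have -> : d * c ^+ 2 = a ^+ 2 - 1 by rewrite -pell; ring.
have -> : 2 * (a * c * (a * M)) + (a ^+ 2 + (a ^+ 2 - 1)) * - (c * M) = c * M.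
  by ring.
by rewrite mulr_ge0 // ltW.
Qed.

Lemma fundamental_domain x : exists y, [/\ qassoc d x y,
  qsize d y <= a * `|qnorm d y| & ~ boundary y].
Proof.
case: (reduced_exists x) => y xy ymin.
have [yb|] := pselect (boundary y); last by exists y.
have [QE nb] := boundary_mul yb; exists (qmul d (a, c) y); split=> //.
  by apply: (qassoc_trans xy); exists (a, c).
by rewrite QE qnormM [qnorm d (a, c)]pell mul1r.
Qed.

(** Size plus norm is [2 * y.1 ^+ 2 = (a + s) * M], with [M] the absolute norm, and [qsize_boundary]
    gives [2 * y.1 * y.2 = - c * M]. Their quotient is the slope, whence the fractions with
    numerator [a + 1] or [a - 1]. *)
Lemma boundary_slope (y : int * int) (s : int) : qnorm d y != 0 -> boundary y ->
  qnorm d y = s * `|qnorm d y| -> c * y.1 = - ((a + s) * y.2).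
Proof.
move=> N0 [QE Plt0] NE; have PE := qsize_boundary QE Plt0.
have y10 : 2 * y.1 != 0.
  by apply: contraTneq Plt0 => h; rewrite -leNgt; nra.
have e2 : 2 * y.1 ^+ 2 = (a + s) * `|qnorm d y|.
  by rewrite [RHS]mulrDl -QE -NE /qsize /qnorm; ring.
apply: (mulfI y10).
have -> : 2 * y.1 * (c * y.1) = c * (2 * y.1 ^+ 2) by ring.
have -> : 2 * y.1 * - ((a + s) * y.2) = - ((a + s) * (2 * (y.1 * y.2))) by ring.
by rewrite e2 PE; ring.
Qed.

(** Converse of [boundary_slope]: scaled by [c ^+ 2], the norm times [s] is [2 * (a + s) * v ^+ 2],
    and the size is [a] times that. *)
Lemma slope_boundary (u v s : int) : 0 < u -> 0 < v -> s ^+ 2 = 1 ->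
  c * u = (a + s) * v ->
  [/\ boundary (u, - v), 0 < s * qnorm d (u, v)
    & qnorm d (u, v) = s * `|qnorm d (u, v)|].
Proof.
move=> u0 v0 s2 uv; have as0 : 0 < a + s.
  by rewrite -(pmulr_lgt0 _ v0) -uv mulr_gt0.
have dc : d * c ^+ 2 = a ^+ 2 - 1 by rewrite -pell; ring.
have cN : c ^+ 2 * (s * qnorm d (u, v)) = 2 * (a + s) * v ^+ 2.
  rewrite /qnorm /=.
  transitivity (s * ((c * u) ^+ 2 - d * c ^+ 2 * v ^+ 2)); first by ring.
  rewrite uv dc; transitivity
    (2 * a * s ^+ 2 * v ^+ 2 + (s ^+ 2 + 1) * s * v ^+ 2).
    ring.
  by rewrite s2; ring.
have cQ : c ^+ 2 * qsize d (u, - v) = a * (2 * (a + s) * v ^+ 2).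
  rewrite /qsize /= sqrrN.
  transitivity ((c * u) ^+ 2 + d * c ^+ 2 * v ^+ 2); first by ring.
  rewrite uv dc; transitivity
    ((2 * a ^+ 2 + 2 * a * s + (s ^+ 2 - 1)) * v ^+ 2).
    ring.
  by rewrite s2; ring.
have c2 : 0 < c ^+ 2 by rewrite exprn_gt0.
have sN : 0 < s * qnorm d (u, v).
  by rewrite -(pmulr_rgt0 _ c2) cN !mulr_gt0 ?exprn_gt0.
have nE : `|qnorm d (u, v)| = s * qnorm d (u, v).
  rewrite -(gtr0_norm sN) normrM; have -> : `|s| = 1; last by rewrite mul1r.
  by move/eqP: s2; rewrite sqrf_eq1 => /orP[]/eqP ->.
split=> //; last by rewrite nE mulrA -expr2 s2 mul1r.
split; last by rewrite /= mulrN oppr_lt0 mulr_gt0.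
rewrite (qnorm_conj d (u, v)) nE; apply: (mulfI (lt0r_neq0 c2)).
by rewrite cQ -cN; ring.
Qed.

(** Two primitive pairs of the same slope agree up to sign, by divisibility of the first coordinates
    in both directions. *)
Lemma boundaryE (y : int * int) (u v s : int) : coprimez u v ->
  coprimez y.1 y.2 -> 0 < u -> 0 < v ->
  s ^+ 2 = 1 -> c * u = (a + s) * v ->
  qnorm d y != 0 -> qnorm d y = s * `|qnorm d y| ->
  boundary y <-> qnorm d y = qnorm d (u, v) /\ (y = (u, - v) \/ y = (- u, v)).
Proof.
move=> cuv cy u0 v0 s2 uv N0 NE; have [bnd _ _] := slope_boundary u0 v0 s2 uv.
split; last first.
  by case=> _ [] -> //; rewrite -[v]opprK; apply/(boundaryN (u, - v)).
move=> yb; have slope := boundary_slope N0 yb NE.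
suff yE : y = (u, - v) \/ y = (- u, v).
  by split=> //; case: yE => ->; rewrite /qnorm /= sqrrN.
have cross : y.1 * v = - (u * y.2).
  apply: (mulfI (lt0r_neq0 c_gt0)).
  by rewrite mulrA slope mulrN [c * (u * _)]mulrA uv; ring.
have d1 : (y.1 %| u)%Z.
  by rewrite -(Gauss_dvdzl _ cy) -[u * _]opprK -cross -mulrN dvdz_mulr.
have d2 : (u %| y.1)%Z.
  by rewrite -(Gauss_dvdzl _ cuv) cross -mulrN dvdz_mulr.
have : `|y.1| = `|u|.
  by apply/eqP; rewrite -!abszE eqz_nat eqn_dvd; apply/andP.
move/eqP; rewrite eqr_norm2 => /orP[]/eqP y1; [left|right].
all: move: cross; rewrite y1 ?mulNr => h; rewrite [y]surjective_pairing y1.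
  by congr pair; apply: (mulfI (lt0r_neq0 u0)); rewrite mulrN h opprK.
by congr pair; apply: (mulfI (lt0r_neq0 u0)); move/oppr_inj: h.
Qed.

(** Here [w] inverts [y.2] modulo the norm [N], so [y.1 * w / N] is [k * w / 2] with [k * w] of the
    parity of [c]. This produces the sign [(-1) ^ (c0 * n)]. *)
Lemma boundary_parity (y : int * int) (w s t : int) : boundary y ->
  qnorm d y = s * `|qnorm d y| -> s ^+ 2 = 1 -> w * y.2 = 1 + t * qnorm d y ->
  exists k l, 2 * y.1 = qnorm d y * k /\ k * w = c + 2 * l.
Proof.
set N := qnorm d y => -[QE Plt0] NE s2 wE; have := qsize_boundary QE Plt0.
have {NE} -> : `|N| = s * N by rewrite [X in s * X]NE mulrA -expr2 s2 mul1r.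
move=> PE; pose k := - (c * s * w) - 2 * y.1 * t.
have kE : 2 * y.1 = N * k.
  transitivity (2 * y.1 * (1 + t * N) - 2 * y.1 * t * N); first by ring.
  rewrite -wE; transitivity (2 * (y.1 * y.2) * w - 2 * y.1 * t * N); first
    by ring.
  by rewrite PE /k; ring.
(* Only [c] odd and [w] even could fail. Then [wE] makes [N] odd, while [PE] would make [c * s * N]
   even. *)
have : exists l, c * (s * w ^+ 2 + 1) = 2 * l.
  have sE : s = 1 \/ s = -1 by move/eqP: s2; rewrite sqrf_eq1 =>
    /orP[]/eqP ->; [left|right].
  have halve (x : int) : exists q b : int, x = 2 * q + b /\ (b = 0 \/ b = 1).
    exists (x %/ 2)%Z, (x %% 2)%Z; lia.
  have [q1 [b1 [cE [b1E|b1E]]]] := halve c.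
    by exists (q1 * (s * w ^+ 2 + 1)); rewrite cE b1E; ring.
  have [q2 [b2 [w2E [b2E|b2E]]]] := halve w; last first.
    by case: sE => ->; [exists (c * (2 * q2 ^+ 2 + 2 * q2 + 1))|exists
      (- c * (2 * q2 ^+ 2 + 2 * q2))]; rewrite w2E b2E; ring.
  have [q3 [b3 [NE [b3E|b3E]]]] := halve N; move: wE PE;
    rewrite w2E b2E NE b3E cE b1E.
    by move=> wE; exfalso; lia.
  by case: sE => -> _ PE; exfalso; lia.
case=> l lE; exists k, (- l - y.1 * t * w); split=> //.
transitivity (c + (- (c * (s * w ^+ 2 + 1)) - 2 * y.1 * t * w)).
  by rewrite /k; ring.
by rewrite lE; ring.
Qed.

Hypothesis a_min : forall p r : int, 1 < p -> 0 < r ->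
  p ^+ 2 - d * r ^+ 2 = 1 -> a <= p.

(** If the second coordinate is nonzero, its absolute value gives a Pell solution below the minimal
    one. *)
Lemma unit_small u : qnorm d u = 1 -> 0 < u.1 -> u.1 < a -> u = (1, 0).
Proof.
case: u => p r /= u1 p0 pa.
have [r0|r0] := eqVneq r 0.
  move: u1; rewrite /qnorm /= r0 expr0n /= mulr0 subr0 => /eqP.
  by rewrite sqrf_eq1 => /orP[]/eqP pE; rewrite pE in p0 *.
have r2 : 0 < r ^+ 2 by rewrite exprn_even_gt0.
have p1 : 1 < p by move: u1 (mulr_gt0 d_gt0 r2); rewrite /qnorm /=; nra.
have := a_min p1 _ _ (r := `|r|); rewrite normr_gt0 real_normK ?num_real//.
by move=> /(_ r0 u1); rewrite leNgt pa.
Qed.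

(** The new first coordinate is [a * p - d * c * r], and [(d * c * r) ^+ 2 = (a ^+ 2 - 1) * (p ^+ 2
    - 1)] lies strictly between the squares of [(a - 1) * p] and [a * p]. *)
Lemma unit_descent u : qnorm d u = 1 -> 0 < u.1 -> 0 < u.2 ->
  let v := qmul d (a, - c) u in 0 < v.1 /\ v.1 < u.1.
Proof.
case: u => p r /= u1 p0 r0.
have dr : d * r ^+ 2 = p ^+ 2 - 1 by rewrite -u1 /qnorm /=; ring.
have dc : d * c ^+ 2 = a ^+ 2 - 1 by rewrite -pell; ring.
have p2 : 1 < p ^+ 2 by rewrite -subr_gt0 -dr mulr_gt0 ?exprn_gt0.
have pa : a <= p.
  by apply: (a_min _ r0 u1); rewrite -ltr_sqr ?nnegrE ?(ltW p0) ?ler01 //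
    expr1n.
have prod : (d * c * r) ^+ 2 = (a ^+ 2 - 1) * (p ^+ 2 - 1).
  by rewrite -dr -dc; ring.
have m0 : 0 < d * c * r by rewrite !mulr_gt0.
split.
  have : (d * c * r) ^+ 2 < (a * p) ^+ 2.
    have -> : (a * p) ^+ 2 = (a ^+ 2 - 1) * (p ^+ 2 - 1) +
      (p ^+ 2 + (a ^+ 2 - 1)).
      by ring.
    by rewrite prod ltrDl -dc addr_gt0 ?mulr_gt0 ?exprn_gt0.
  rewrite ltr_sqr ?nnegrE; last first.
  - by rewrite mulr_ge0 ?(ltW p0) ?(ltW (lt_trans ltr01 a_gt1)).
  - exact: ltW.
  by lra.
have : ((a - 1) * p) ^+ 2 < (d * c * r) ^+ 2.
  have -> : (d * c * r) ^+ 2 = ((a - 1) * p) ^+ 2 + (a - 1) *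
    (2 * p ^+ 2 - a - 1).
    by rewrite prod; ring.
  by rewrite ltrDl mulr_gt0 ?subr_gt0 //; nra.
rewrite ltr_sqr ?nnegrE; last first.
- exact: ltW.
- by rewrite mulr_ge0 ?subr_ge0 ?(ltW p0) ?(ltW a_gt1).
by lra.
Qed.

End Fundamental.

(** * The exponential and real embeddings *)

Lemma eeE (R : realType) (x : R) :
  ee x = Complex (cos (2 * pi * x)) (sin (2 * pi * x)).
Proof.
rewrite /ee.
have -> : 2 * (pi : R)%:C%C * Complex 0 1 * x%:C%C = Complex 0 (2 * pi * x).
  have -> : 2 = (2 : R)%:C%C by rewrite rmorph_nat.
  by rewrite -rmorphM /=; apply/eqP; rewrite eq_complex /=; apply/andP; split;
    apply/eqP; ring.
rewrite /cexp /= expR0.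
by apply/eqP; rewrite eq_complex /=; apply/andP; split; apply/eqP; ring.
Qed.

Lemma eeDn (R : realType) (x : R) (k : nat) : ee (x + k%:R) = ee x.
Proof.
rewrite !eeE mulrDr.
have -> : 2 * pi * k%:R = pi *+ 2 *+ k :> R
  by rewrite -[RHS]mulr_natr -[pi *+ 2]mulr_natl.
by rewrite (periodicn (@cosD2pi R)) (periodicn (@sinD2pi R)).
Qed.

Lemma eeD_int (R : realType) (x : R) (k : int) : ee (x + k%:~R) = ee x.
Proof.
case: k => k; first by rewrite -pmulrn eeDn.
by rewrite NegzE rmorphN /= -pmulrn -[in RHS](subrK k.+1%:R x) eeDn.
Qed.

Lemma ee_half (R : realType) (k : int) : ee (k%:~R / 2 : R) = (-1) ^ k.
Proof.
have ee0 : ee (0 : R) = 1 by rewrite eeE mulr0 cos0 sin0.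
have eeh : ee (2^-1 : R) = -1.
  rewrite eeE; have -> : 2 * pi * 2^-1 = pi :> R by field.
  by rewrite cospi sinpi; apply/eqP; rewrite eq_complex /= oppr0 !eqxx.
have [q [b [-> bE]]] : exists q b : int, k = q * 2 + b /\ (b = 0 \/ b = 1).
  exists (k %/ 2)%Z, (k %% 2)%Z; lia.
have -> : (q * 2 + b)%:~R / 2 = b%:~R / 2 + q%:~R :> R.
  by rewrite rmorphD rmorphM /=; field.
rewrite exprzDr ?unitrN1 // [q * 2]mulrC -exprz_exp.
have -> : (-1 : R[i]) ^ (2 : int) = 1 by rewrite -exprnP sqrrN expr1n.
rewrite exp1rz mul1r.
by rewrite eeD_int; case: bE => ->;
  rewrite ?mul0r ?mul1r ?ee0 ?eeh ?expr0z ?expr1z.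
Qed.

Lemma invmodzP (N g : int) : coprimez g N ->
  exists t, invmodz N g * g = 1 + t * N.
Proof.
rewrite /invmodz; have [->|g0] := eqVneq g 0 => cop.
  (* For [g = 0] coprimality makes [N] invertible in the integers, so the default value [0] is an
     inverse of [g] modulo [N]. *)
  have [u [v]] := (coprimez_exP _ _).1 cop; rewrite mulr0 add0r => vN.
  by exists (- v); rewrite mulr0 mulNr vN subrr.
case: egcdzP => u v uv _ /=; exists (- v).
by move/eqP: cop => cop; rewrite mulNr -cop -uv addrK.
Qed.

Section Quadratic.

Variables (R : realType) (s : R) (d : int).
Hypotheses (s_gt0 : 0 < s) (s2 : s ^+ 2 = d%:~R).

Definition qval (x : int * int) : R := x.1%:~R + x.2%:~R * s.

Lemma qval_mul u x : qval (qmul d u x) = qval u * qval x.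
Proof. by rewrite /qval /= !(rmorphD, rmorphM) /= -s2; ring. Qed.

Lemma qconj_mul u x : qconj (qmul d u x) = qmul d (qconj u) (qconj x).
Proof. by congr pair => /=; ring. Qed.

Lemma qval_conj x : qval x * qval (qconj x) = (qnorm d x)%:~R.
Proof. by rewrite /qval /qnorm /= !(rmorphD, rmorphM, rmorphN) /= -s2;
  ring. Qed.

Lemma qvalN x : qval (- x) = - qval x.
Proof. by rewrite /qval /= !rmorphN /=; ring. Qed.

Lemma qval_sum x : qval x + qval (qconj x) = 2 * x.1%:~R.
Proof. by rewrite /qval /= rmorphN /=; ring. Qed.

Lemma qval_neq0 x : qnorm d x != 0 -> qval x != 0.
Proof.
by move=> N0; apply: contra_neq N0 => x0; apply/eqP;
  rewrite -(intr_eq0 R) -qval_conj x0 mul0r.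
Qed.

Lemma qval_sqr_sum x :
  qval x ^+ 2 + qval (qconj x) ^+ 2 = 2 * (qsize d x)%:~R.
Proof. by rewrite /qval /qsize /= !(rmorphD, rmorphM, rmorphN) /= -s2;
  ring. Qed.

(** The conjugates of [u] have product [1], hence equal signs, and their sum is [2 * u.1]. *)
Lemma unit_gt0 u : qnorm d u = 1 -> (0 < qval u) = (0 < u.1).
Proof.
move=> u1; have := qval_conj u; rewrite u1 => prod.
rewrite -(ltr0z R); have := qval_sum u; move: prod.
move: (qval u) (qval _) => x y prod sum.
apply/idP/idP => h; first by nra.
by nra.
Qed.

End Quadratic.

(** * Powers of the fundamental unit and uniqueness of reduced elements *)

Section Reduction.

Variables (R : realType) (s : R) (d a c : int).
Hypotheses (s_gt0 : 0 < s) (s2 : s ^+ 2 = d%:~R).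
Hypotheses (d_gt0 : 0 < d) (a_gt1 : 1 < a) (c_gt0 : 0 < c).
Hypothesis pell : a ^+ 2 - d * c ^+ 2 = 1.
Hypothesis a_min : forall p r : int, 1 < p -> 0 < r ->
  p ^+ 2 - d * r ^+ 2 = 1 -> a <= p.

Local Notation eps := (qval s (a, c)).

Lemma eps_gt1 : 1 < eps.
Proof.
have a1 : 1 < a%:~R :> R by rewrite ltr1z.
have cs : 0 < c%:~R * s by rewrite mulr_gt0 ?ltr0z.
by rewrite /qval /=; lra.
Qed.

Lemma epsV : eps * qval s (a, - c) = 1.
Proof. by rewrite (qval_conj s2 (a, c)) [qnorm _ _]pell. Qed.

Lemma eps_trace : eps ^+ 2 + 1 = 2 * a%:~R * eps.
Proof.
have /= <- := qval_sum s (a, c).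
by rewrite mulrDl [qval s (qconj _) * _]mulrC epsV.
Qed.

Lemma eps_gt0 : 0 < eps. Proof. exact: lt_trans ltr01 eps_gt1. Qed.

(** Positive units are powers of [eps], stated through logarithms because only these enter the
    phase. The induction divides by [eps] using [unit_descent]; conjugation inverts a unit and
    handles negative exponents. *)
Lemma unit_log_pos (n : nat) u : qnorm d u = 1 -> 0 < u.1 -> u.1 <= n%:Z ->
  exists j : int, ln (qval s u) = j%:~R * ln eps.
Proof.
elim: n u => [|n IHn] u u1 p0 un; first by move: (lt_le_trans p0 un);
  rewrite ltxx.
have step w : qnorm d w = 1 -> 0 < w.1 -> w.1 <= n.+1%:Z -> 0 < w.2 ->
    exists j : int, ln (qval s w) = j%:~R * ln eps.
  move=> w1 w10 wn w20.
  have [] := unit_descent d_gt0 a_gt1 c_gt0 pell a_min w1 w10 w20.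
  set v := qmul _ _ _ => v0 vw.
  have v1 : qnorm d v = 1 by rewrite qnormM w1 (qnorm_conj d (a, c))
    [qnorm _ _]pell.
  have wE : w = qmul d (a, c) v.
    rewrite qmulA; have -> : qmul d (a, c) (a, - c) = (1, 0); last
      by rewrite qmul1.
    by congr pair => /=; rewrite -?pell; ring.
  have [|j jE] := IHn v v1 v0; first by lia.
  exists (1 + j); rewrite wE (qval_mul s2) lnM ?posrE ?eps_gt0
    ?(unit_gt0 s2 v1) //.
  by rewrite jE rmorphD /= mulrDl mul1r.
have [u2|u2|u2] := ltgtP u.2 0.
- have [|||| j jE] := step (qconj u); rewrite ?qnorm_conj /= ?oppr_gt0 //.
  exists (- j); rewrite rmorphN /= mulNr -jE.
  have upos : 0 < qval s u by rewrite (unit_gt0 s2 u1).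
  have cE : qval s (qconj u) = (qval s u)^-1.
    apply: (mulfI (lt0r_neq0 upos)).
    by rewrite (qval_conj s2) u1 divff ?lt0r_neq0.
  by rewrite cE lnV ?posrE // opprK.
- exact: step.
exists 0; rewrite mul0r; have -> : qval s u = 1; last exact: ln1.
case: u u1 p0 u2 un => p r /= u1 p0 r0 _; move: u1.
rewrite /qnorm /qval /= r0 expr0n /= mulr0 subr0 mul0r addr0 => /eqP.
by rewrite sqrf_eq1 => /orP[]/eqP pE; move: p0; rewrite pE.
Qed.

Lemma unit_log u : qnorm d u = 1 ->
  exists j : int, ln `|qval s u| = j%:~R * ln eps.
Proof.
move=> u1; have [u0|u0|u0] := ltgtP u.1 0.
- have u1' : qnorm d (- u) = 1 by rewrite -u1 /qnorm /= !sqrrN.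
  have u0' : 0 < (- u).1 by rewrite oppr_gt0.
  have upos : 0 < qval s (- u) by rewrite (unit_gt0 s2 u1').
  rewrite -normrN -qvalN gtr0_norm //.
  by apply: (unit_log_pos (n := `|(- u).1|%N) u1' u0');
    rewrite gez0_abs ?(ltW u0').
- rewrite gtr0_norm ?(unit_gt0 s2 u1) //.
  by apply: (unit_log_pos (n := `|u.1|%N) u1 u0); rewrite gez0_abs ?(ltW u0).
by exfalso; move: u1; rewrite /qnorm u0; have :=
  mulr_ge0 (ltW d_gt0) (sqr_ge0 u.2); lra.
Qed.

Definition qratio x : R := `|qval s x / qval s (qconj x)|.

(** Since [u' = u^-1], multiplying by [u] multiplies [x / x'] by [u ^+ 2]. The logarithm thus moves
    by a multiple of [ell_eta]. *)
Lemma qratio_assoc x y : qnorm d x != 0 -> qassoc d x y ->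
  exists j : int, ln (qratio y) = ln (qratio x) + 2 * j%:~R * ln eps.
Proof.
move=> N0 [u u1 ->]; have [j jE] := unit_log u1; exists j.
have u0 : qval s u != 0 by rewrite (qval_neq0 s2) // u1.
have x0 := qval_neq0 s2 N0.
have x0' : qval s (qconj x) != 0 by rewrite (qval_neq0 s2) // qnorm_conj.
have cE : qval s (qconj u) = (qval s u)^-1.
  by apply: (mulfI u0); rewrite (qval_conj s2) u1 divff.
rewrite /qratio qconj_mul !(qval_mul s2) cE.
have -> : qval s u * qval s x / ((qval s u)^-1 * qval s (qconj x)) =
    qval s u * (qval s u * (qval s x / qval s (qconj x))).
  by field; rewrite ?u0 ?x0'.
have r0 : 0 < `|qval s x / qval s (qconj x)|
  by rewrite normr_gt0 mulf_neq0 ?invr_eq0.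
move: (qval s x / _) r0 => r r0; have un0 : 0 < `|qval s u|
  by rewrite normr_gt0.
by rewrite 2!normrM 2?lnM ?posrE ?mulr_gt0 // jE; ring.
Qed.

Lemma qratio_bounds x : qnorm d x != 0 -> qsize d x <= a * `|qnorm d x| ->
  `|qval s x| <= eps * `|qval s (qconj x)| /\ `|qval s (qconj x)| <= eps *
    `|qval s x|.
Proof.
move=> N0; have := qval_sqr_sum s2 x; have := qval_conj s2 x.
move=> /(congr1 Num.norm); rewrite normrM -intr_norm.
rewrite -(real_normK (num_real (qval s x)))
  -(real_normK (num_real (qval s (qconj x)))).
have := normr_ge0 (qval s x); have := normr_ge0 (qval s (qconj x)).
move: `|qval s x| `|qval s (qconj x)| => p q q0 p0 pq sq.
rewrite -(ler_int R) rmorphM /= -pq => le1.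
have [e1 tr] := (eps_gt1, eps_trace).
(* The product is [2 * eps * (qsize d x - a * |qnorm d x|)]. If either bound failed, both factors
   would have the same strict sign. *)
have key : (p - eps * q) * (eps * p - q) <= 0.
  have -> : (p - eps * q) * (eps * p - q) = eps * (p ^+ 2 + q ^+ 2) -
    (eps ^+ 2 + 1) * (p * q).
    by ring.
  rewrite tr sq; have := ler_wpM2l (ltW eps_gt0) le1; lra.
have ep : p <= eps * p by rewrite ler_peMl // ltW.
have eq : q <= eps * q by rewrite ler_peMl // ltW.
split; rewrite leNgt; apply/negP => h; move: key; apply/negP; rewrite -ltNge.
  by rewrite mulr_gt0 // subr_gt0; lra.
by rewrite nmulr_rgt0 subr_lt0; lra.
Qed.

Lemma qval_sqr_diff x :
  qval s (qconj x) ^+ 2 - qval s x ^+ 2 = - (4 * s) * (x.1 * x.2)%:~R.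
Proof. by rewrite /qval /= rmorphN rmorphM /=; ring. Qed.

(** Equality in the size bound makes one of the two factors vanish; coordinates of opposite sign
    give [|x| < |x'|] and decide which. *)
Lemma qratio_boundary x : qnorm d x != 0 -> boundary d a x ->
  `|qval s (qconj x)| = eps * `|qval s x|.
Proof.
move=> N0 [QE Plt0]; have := qval_sqr_sum s2 x; have := qval_conj s2 x.
have lt : qval s x ^+ 2 < qval s (qconj x) ^+ 2.
  by rewrite -subr_gt0 qval_sqr_diff nmulr_rgt0 ?ltrz0 // oppr_lt0 mulr_gt0.
move=> /(congr1 Num.norm); rewrite normrM -intr_norm; move: lt.
rewrite -(real_normK (num_real (qval s x)))
  -(real_normK (num_real (qval s (qconj x)))).
have := normr_ge0 (qval s x); have := normr_ge0 (qval s (qconj x)).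
rewrite QE; move: `|qval s x| `|qval s (qconj x)| => p q q0 p0 lt pq sq.
have [e1 tr] := (eps_gt1, eps_trace).
rewrite ltr_sqr ?nnegrE // in lt.
have key : (p - eps * q) * (eps * p - q) = 0.
  have -> : (p - eps * q) * (eps * p - q) = eps * (p ^+ 2 + q ^+ 2) -
    (eps ^+ 2 + 1) * (p * q).
    by ring.
  by rewrite tr sq pq rmorphM /=; ring.
move/eqP: key; rewrite mulf_eq0 !subr_eq0 => /orP[]/eqP // h.
have eq : q <= eps * q by rewrite ler_peMl // ltW.
by move: lt; rewrite h ltNge eq.
Qed.

Lemma ln_qratio_boundary x : qnorm d x != 0 -> boundary d a x ->
  ln (qratio x) = - ln eps.
Proof.
move=> N0 xb; rewrite /qratio normrM normfV (qratio_boundary N0 xb) invfM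
  mulrCA divff.
  by rewrite mulr1 lnV ?posrE ?eps_gt0.
by rewrite normr_eq0 (qval_neq0 s2).
Qed.

(** Equality [|x'| = eps * |x|] would conversely make [x] a boundary point. This makes the range
    half-open. *)
Lemma qratio_strict x : qnorm d x != 0 -> qsize d x <= a * `|qnorm d x| ->
  ~ boundary d a x -> `|qval s (qconj x)| < eps * `|qval s x|.
Proof.
move=> N0 le1 nb; have [_] := qratio_bounds N0 le1.
rewrite le_eqVlt => /orP[/eqP h|//]; exfalso; apply: nb.
have p0 : 0 < `|qval s x| by rewrite normr_gt0 (qval_neq0 s2).
split.
  apply: (@intr_inj R); apply: (mulfI (_ : 2 != 0 :> R)) => //.
  rewrite -(qval_sqr_sum s2) -(real_normK (num_real (qval s x))).
  rewrite -(real_normK (num_real (qval s (qconj x)))) rmorphM /= intr_norm.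
  rewrite -(qval_conj s2) normrM h.
  transitivity ((eps ^+ 2 + 1) * `|qval s x| ^+ 2); first by ring.
  by rewrite eps_trace; ring.
have lt : qval s x ^+ 2 < qval s (qconj x) ^+ 2.
  rewrite -(real_normK (num_real (qval s x)))
    -(real_normK (num_real (qval s (qconj x)))).
  by rewrite ltr_sqr ?nnegrE ?normr_ge0 // h ltr_pMl // eps_gt1.
move: lt; rewrite -subr_gt0 qval_sqr_diff.
by rewrite nmulr_rgt0 ?ltrz0 // oppr_lt0 mulr_gt0.
Qed.

(** Write [y = u * x] with [u > 0]. The half-open ranges force [u / u'] strictly between [eps^-2]
    and [eps^2]; as [u * u' = 1], both conjugates are below [eps], and [unit_small] leaves only
    [u = 1]. *)
Lemma reduced_unique x y : qnorm d x != 0 -> qassoc d x y ->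
  0 < qval s x -> 0 < qval s y ->
  qsize d x <= a * `|qnorm d x| -> ~ boundary d a x ->
  qsize d y <= a * `|qnorm d y| -> ~ boundary d a y -> x = y.
Proof.
move=> Nx xy x0 y0 lex nbx ley nby.
have Ny : qnorm d y != 0 by rewrite (qassoc_norm xy).
have [lx _] := qratio_bounds Nx lex; have ltx := qratio_strict Nx lex nbx.
have [ly _] := qratio_bounds Ny ley; have lty := qratio_strict Ny ley nby.
case: xy y0 ly lty => u u1 ->; rewrite qconj_mul !(qval_mul s2) !normrM.
rewrite pmulr_lgt0 // => upos; rewrite !(gtr0_norm upos) => ly lty.
have uE := qval_conj s2 u; rewrite u1 in uE.
have u'pos : 0 < qval s (qconj u) by rewrite -(pmulr_rgt0 _ upos) uE.
rewrite (gtr0_norm u'pos) in ly lty.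
suff small : u.1 < a.
  have u10 : 0 < u.1 by rewrite -(unit_gt0 s2 u1).
  by rewrite (unit_small d_gt0 a_min u1 u10 small) qmul1.
have tr := qval_sum s u.
have p0 : 0 < `|qval s x| by rewrite normr_gt0 lt0r_neq0.
have q0 : 0 < `|qval s (qconj x)|
  by rewrite normr_gt0 (qval_neq0 s2) // qnorm_conj.
move: upos u'pos uE tr p0 q0 lx ltx ly lty.
move: `|qval s x| `|qval s (qconj x)| (qval s u) (qval s (qconj u)) =>
  p q al be.
move=> al0 be0 albe tr p0 q0 lx ltx ly lty.
have e0 := eps_gt0.
have alb : al < eps ^+ 2 * be.
  rewrite -(ltr_pM2r p0); apply: (le_lt_trans ly).
  have -> : eps ^+ 2 * be * p = eps * be * (eps * p) by ring.
  by rewrite [X in X < _]mulrA ltr_pM2l // mulr_gt0.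
have bea : be < eps ^+ 2 * al.
  rewrite -(ltr_pM2r q0); apply: (lt_le_trans lty).
  have -> : eps ^+ 2 * al * q = eps * al * (eps * q) by ring.
  by rewrite [X in X <= _]mulrA ler_pM2l // mulr_gt0.
have al1 : al < eps.
  rewrite -ltr_sqr ?nnegrE ?ltW //.
  have -> : eps ^+ 2 = eps ^+ 2 * be * al
    by rewrite -mulrA [be * _]mulrC albe mulr1.
  by rewrite expr2 ltr_pM2r.
have be1 : be < eps.
  rewrite -ltr_sqr ?nnegrE ?ltW //.
  have -> : eps ^+ 2 = eps ^+ 2 * al * be by rewrite -mulrA albe mulr1.
  by rewrite expr2 ltr_pM2r.
(* Expanded, this says [u + u' < eps + eps^-1], that is [u.1 < a]. *)
have : 0 < (eps - al) * (eps - be) by rewrite mulr_gt0 ?subr_gt0.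
have -> : (eps - al) * (eps - be) = eps ^+ 2 + al * be - eps * (al + be)
  by ring.
rewrite albe tr eps_trace subr_gt0 -(ltr_int R).
have -> : eps * (2 * u.1%:~R) = 2 * eps * u.1%:~R by ring.
have -> : 2 * a%:~R * eps = 2 * eps * a%:~R by ring.
by rewrite ltr_pM2l // mulr_gt0.
Qed.

End Reduction.

(** * Double cosets *)

Section Matrices.
Variable T : comNzRingType.

Lemma mx2_eta (A : 'M[T]_2) : A = mx2 (A 0 0) (A 0 1) (A 1 0) (A 1 1).
Proof.
apply/matrixP => i j; rewrite mxE.
by case: i j => [[|[|//]] ?] [[|[|//]] ?] /=; congr (A _ _); apply/val_inj.
Qed.

Lemma mx2E (a b c d : T) : ((mx2 a b c d 0 0 = a) * (mx2 a b c d 0 1 = b) *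
  (mx2 a b c d 1 0 = c) * (mx2 a b c d 1 1 = d))%type.
Proof. by rewrite /mx2 !mxE. Qed.

Lemma mulmx2E (A B : 'M[T]_2) (i j : 'I_2) :
  (A *m B) i j = A i 0 * B 0 j + A i 1 * B 1 j.
Proof. by rewrite mxE big_ord_recl big_ord1; congr (_ + A _ _ * B _ _);
  apply/val_inj. Qed.

Lemma det_mx2E (A : 'M[T]_2) : \det A = A 0 0 * A 1 1 - A 0 1 * A 1 0.
Proof.
rewrite (expand_det_row _ 0) big_ord_recl big_ord1 /cofactor !det_mx11 !mxE /=.
rewrite expr0 expr1 mul1r mulN1r mulrN.
by congr (A _ _ * A _ _ - A _ _ * A _ _); apply/val_inj.
Qed.

Lemma mx2P (A B : 'M[T]_2) : A 0 0 = B 0 0 -> A 0 1 = B 0 1 -> A 1 0 = B 1 0 ->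
  A 1 1 = B 1 1 -> A = B.
Proof. by move=> h1 h2 h3 h4; rewrite [A]mx2_eta [B]mx2_eta h1 h2 h3 h4. Qed.

End Matrices.

Definition fst_col (g : 'M[int]_2) : int * int := (g 0 0, g 1 0).

(** Any completion of a primitive column to determinant [1] would serve, since by [double_cosetP]
    the coset depends only on that column. *)
Definition bezout_mx (x : int * int) : 'M[int]_2 :=
  mx2 x.1 (- (egcdz x.1 x.2).2) x.2 (egcdz x.1 x.2).1.

Lemma bezout_mx_fst_col x : fst_col (bezout_mx x) = x.
Proof. by case: x => e g; rewrite /fst_col /bezout_mx !mx2E. Qed.

Lemma bezout_mx_Gamma x : coprimez x.1 x.2 -> Gamma (bezout_mx x).
Proof.
move=> cx; rewrite /Gamma /= det_mx2E /bezout_mx !mx2E.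
case: egcdzP => u v uv _ /=; move/eqP: cx uv => ->.
by move=> <-; ring.
Qed.

Lemma Gamma_coprime g : Gamma g -> coprimez (fst_col g).1 (fst_col g).2.
Proof.
rewrite /Gamma /= det_mx2E => g1; apply/coprimez_exP.
by exists (g 1 1), (- g 0 1); rewrite -g1 /=; ring.
Qed.

(** * Stabilizers and double cosets in terms of first columns *)

Section Coset.

Variables (R : realType) (D : nat).
Hypothesis D_gt0 : (0 < D)%N.

Local Notation s := (Num.sqrt D%:R : R).

Lemma sqrtD_gt0 : 0 < s. Proof. by rewrite sqrtr_gt0 ltr0n. Qed.

Lemma sqrtD_sqr : s ^+ 2 = D%:Z%:~R. Proof. by rewrite sqr_sqrtr ?ler0n. Qed.

Let s_gt0 := sqrtD_gt0.
Let s2 := sqrtD_sqr.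

Lemma scaledE g : scaled R D g = (Num.sqrt (2 * s))^-1 *:
  mx2 ((g 0 0)%:~R + s * (g 1 0)%:~R) ((g 0 1)%:~R + s * (g 1 1)%:~R)
      (s * (g 1 0)%:~R - (g 0 0)%:~R) (s * (g 1 1)%:~R - (g 0 1)%:~R).
Proof.
have k2 : Num.sqrt (2 * s) ^+ 2 = 2 * s by rewrite sqr_sqrtr // mulr_ge0 // ltW.
have k0 : Num.sqrt (2 * s) != 0 by rewrite lt0r_neq0 // sqrtr_gt0 mulr_gt0.
(* [tau] is the adjugate of [sigma_eta], whose determinant is [1]. *)
rewrite /scaled; pose tau : 'M[R]_2 := (Num.sqrt (2 * s))^-1 *: mx2 1 s (- 1) s.
have sigtau : sigma_eta R D *m tau = 1%:M.
  rewrite /sigma_eta /tau -scalemxAl -scalemxAr scalerA -invfM -expr2 k2.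
  have ds : 2 * s != 0 by rewrite lt0r_neq0 // mulr_gt0.
  by apply: mx2P; rewrite mxE mulmx2E !mx2E [RHS]mxE /=; field;
    rewrite lt0r_neq0.
have [usig _] := mulmx1_unit sigtau.
have -> : invmx (sigma_eta R D) = tau.
  by rewrite -[RHS]mul1mx -(mulVmx usig) -mulmxA sigtau mulmx1.
rewrite /tau -scalemxAl; congr (_ *: _).
by apply: mx2P; rewrite mulmx2E !mx2E !mxE; ring.
Qed.

Lemma scaled_entries g (k := Num.sqrt (2 * s)) :
  [/\ scaled R D g 0 0 = k^-1 * ((g 0 0)%:~R + s * (g 1 0)%:~R),
      scaled R D g 0 1 = k^-1 * ((g 0 1)%:~R + s * (g 1 1)%:~R),
      scaled R D g 1 0 = k^-1 * (s * (g 1 0)%:~R - (g 0 0)%:~R) &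
      scaled R D g 1 1 = k^-1 * (s * (g 1 1)%:~R - (g 0 1)%:~R)].
Proof. by rewrite scaledE; split; rewrite mxE mx2E. Qed.

Lemma scaled_prod g :
  scaled R D g 0 0 * scaled R D g 1 0 = - (qnorm D (fst_col g))%:~R / (2 * s).
Proof.
have k2 : Num.sqrt (2 * s) ^+ 2 = 2 * s by rewrite sqr_sqrtr // mulr_ge0 // ltW.
have [-> _ -> _] := scaled_entries g; rewrite mulrACA -invfM -expr2 k2 mulrC;
  congr (_ / _).
by rewrite /qnorm /= !(rmorphD, rmorphM, rmorphN) /= -s2; ring.
Qed.

(** The sum and the difference of the two fixed-point equations give [g 0 1 = D * g 1 0] and
    [g 0 0 = g 1 1]. Such a matrix is multiplication by [u] in the basis [1, sqrt D]. *)
Lemma Gamma_etaP g : Gamma_eta R D g <->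
  exists2 u, qnorm D u = 1 & g = mx2 u.1 (D%:Z * u.2) u.2 u.1.
Proof.
split.
  case=> -[g1 hm] [_ hp]; move: hm hp; rewrite /mobius !mxE.
  case: eqP => // dm [em]; case: eqP => // dp [ep].
  have {}em : (g 0 0)%:~R * - s + (g 0 1)%:~R = - s *
    ((g 1 0)%:~R * - s + (g 1 1)%:~R).
    by rewrite -{2}em divfK //; apply/eqP.
  have {}ep : (g 0 0)%:~R * s + (g 0 1)%:~R = s *
    ((g 1 0)%:~R * s + (g 1 1)%:~R).
    by rewrite -{2}ep divfK //; apply/eqP.
  have g01 : g 0 1 = D%:Z * g 1 0.
    by apply: (@intr_inj R); rewrite rmorphM /= -s2; lra.
  have g00 : g 0 0 = g 1 1.
    apply: (@intr_inj R); apply: (mulIf (lt0r_neq0 s_gt0)); lra.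
  exists (g 1 1, g 1 0); last by rewrite -g01 -{1}g00 -mx2_eta.
  by rewrite -[RHS]g1 det_mx2E g00 g01 /qnorm /=; ring.
case=> u u1 ->; have g1 : Gamma (mx2 u.1 (D%:Z * u.2) u.2 u.1).
  by rewrite /Gamma /= det_mx2E !mx2E -u1 /qnorm; ring.
have u0 := qval_neq0 s2 (x := u); have u0' := qval_neq0 s2 (x := qconj u).
rewrite qnorm_conj u1 in u0 u0'; move: u0 u0'; rewrite /qval /=.
move=> /(_ isT) u0 /(_ isT) u0'; rewrite rmorphN /= in u0'.
split; split=> //; rewrite /mobius !mxE /= rmorphM /= -s2.
  rewrite ifN; last by rewrite addrC mulrN -mulNr.
  by congr Some; field; rewrite addrC mulrN -mulNr.
rewrite ifN; last by rewrite addrC.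
by congr Some; field; rewrite addrC.
Qed.

Lemma Gamma_inftyP g : Gamma_infty R g <-> Gamma g /\ g 1 0 = 0.
Proof.
rewrite /Gamma_infty /stab /mobius /= !mxE intr_eq0.
by split=> -[g1]; case: eqP => // h.
Qed.

(** Left factors multiply the first column by a unit, and right factors change at most its sign.
    Conversely, matrices of determinant [1] with equal first columns differ by a unipotent right
    factor. *)
Lemma double_cosetP g h : Gamma g ->
  double_coset R D g h <-> Gamma h /\ qassoc D (fst_col g) (fst_col h).
Proof.
move=> g1; split.
  case=> k1 [k2 [/Gamma_etaP[u u1 k1E] /Gamma_inftyP[k21 k20] ->]].
  have dk1 : \det k1 = 1 by rewrite k1E det_mx2E !mx2E -u1 /qnorm; ring.
  split; first by rewrite /Gamma /= !det_mulmx dk1 g1 k21 !mulr1.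
  have k2u : k2 0 0 * k2 1 1 = 1 by move: k21;
    rewrite /Gamma /= det_mx2E k20 mulr0 subr0.
  have k2s : k2 0 0 ^+ 2 = 1.
    by move: k2u; rewrite mulrC => /intUnitRing.unitzPl /orP[]/eqP ->.
  apply: (@qassoc_trans _ _ (qmul D u (fst_col g))); first by exists u.
  exists (k2 0 0, 0); first by rewrite /qnorm /= k2s; ring.
  by congr pair; rewrite !mulmx2E k20 k1E !mx2E /=; ring.
case=> h1 [u u1 uh]; pose k1 := mx2 u.1 (D%:Z * u.2) u.2 u.1.
have dk1 : \det k1 = 1 by rewrite det_mx2E !mx2E -u1 /qnorm; ring.
have k1g : Gamma (k1 *m g) by rewrite /Gamma /= det_mulmx dk1 g1 mulr1.
have e0 : (k1 *m g) 0 0 = h 0 0.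
  by case: uh => -> _; rewrite mulmx2E !mx2E.
have e1 : (k1 *m g) 1 0 = h 1 0.
  by case: uh => _ ->; rewrite mulmx2E !mx2E.
have dA : \det (k1 *m g) = 1 := k1g.
move: dA e0 e1; set A := k1 *m g; rewrite det_mx2E => dA e0 e1.
move: (h1); rewrite /Gamma /= det_mx2E => dh.
(* The second matrix is [A^-1 *m h]. *)
exists k1, (mx2 1 (A 1 1 * h 0 1 - A 0 1 * h 1 1) 0 1); split.
- by apply/Gamma_etaP; exists u.
- by apply/Gamma_inftyP; rewrite /Gamma /= det_mx2E !mx2E; split => //; ring.
apply: mx2P; rewrite mulmx2E !mx2E ?mulr1 ?mulr0 ?addr0 //.
  transitivity (h 0 1 * (A 0 0 * A 1 1 - A 0 1 * A 1 0)
    - A 0 1 * (h 0 0 * h 1 1 - h 0 1 * h 1 0) + A 0 1); last by rewrite e0 e1;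
      ring.
  by rewrite dA dh; ring.
transitivity (h 1 1 * (h 0 0 * A 1 1 - A 0 1 * h 1 0)
  - A 1 1 * (h 0 0 * h 1 1 - h 0 1 * h 1 0) + A 1 1); last by rewrite e1; ring.
by rewrite -{1}e0 -{1}e1 dA dh; ring.
Qed.

End Coset.

(** * Comparison of the two sums *)

Section DoubleCosetSum.

Variables (R : realType) (D a0 c0 : nat).
Hypothesis D_gt0 : (0 < D)%N.
Hypothesis hpell : pell_fundamental D a0 c0.

Local Notation s := (Num.sqrt D%:R : R).
Local Notation eps := (qval s (a0%:Z, c0%:Z)).

Let s_gt0 : 0 < s := sqrtD_gt0 R D_gt0.
Let s2 : s ^+ 2 = D%:Z%:~R := sqrtD_sqr R D.
Let dZ : 0 < D%:Z. Proof. by []. Qed.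
Let aZ : 1 < a0%:Z. Proof. by case: hpell. Qed.
Let cZ : 0 < c0%:Z. Proof. by case: hpell. Qed.
Let pellZ : a0%:Z ^+ 2 - D%:Z * c0%:Z ^+ 2 = 1. Proof. by case: hpell. Qed.

Let minZ (p r : int) : 1 < p -> 0 < r -> p ^+ 2 - D%:Z * r ^+ 2 = 1 ->
  a0%:Z <= p.
Proof.
by case: hpell => _ _ _ h; case: p r => [p|p] [r|r] // p1 r0 /(h p r p1 r0).
Qed.

Lemma ell_etaE : ell_eta R D a0 c0 = 2 * ln eps.
Proof. by rewrite /ell_eta /epsD /qval /= -!pmulrn [s * _]mulrC. Qed.

Let lneps : ln eps != 0.
Proof. by rewrite lt0r_neq0 // ln_gt0 // (eps_gt1 s_gt0 aZ cZ). Qed.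

Variables (m n N : int).
Hypothesis N0 : N != 0.

Local Notation F := (R_summand R D a0 c0 m n N).

Lemma R_summandE x : F x = ee (m%:~R / ell_eta R D a0 c0 * ln (qratio s x)
  - n%:~R * (x.1 * invmodz N x.2)%:~R / N%:~R).
Proof.
by rewrite /R_summand /qratio /qval /= rmorphN mulNr rmorphM /= mulrA.
Qed.

(** The logarithmic phase moves by an integer. For the other one,
    [y.1 * x.2 - x.1 * y.2 = - u.2 * N], so [e g^-1] modulo [N] is constant on orbits. *)
Lemma R_summand_assoc x y : coprimez x.1 x.2 -> qnorm D x = N ->
  qassoc D x y -> F y = F x.
Proof.
move=> cx Nx xy; rewrite !R_summandE.
have Ny : qnorm D y = N by rewrite (qassoc_norm xy).
have Nx0 : qnorm D x != 0 by rewrite Nx.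
have [j ->] := qratio_assoc s_gt0 s2 dZ aZ cZ pellZ minZ Nx0 xy.
have [t tE] : exists t, invmodz N x.2 * x.2 = 1 + t * N.
  by apply: invmodzP; rewrite -Nx coprimez_qnorm.
have [t' t'E] : exists t, invmodz N y.2 * y.2 = 1 + t * N.
  by apply: invmodzP; rewrite -Ny coprimez_qnorm // (qassoc_coprime xy).
move: tE t'E; set w := invmodz N x.2; set w' := invmodz N y.2 => tE t'E.
have [k kE] : exists k, y.1 * w' - x.1 * w = k * N.
  case: xy => u u1 yE.
  exists (- u.2 * w * w' - y.1 * w' * t + x.1 * w * t').
  transitivity (y.1 * w' * (w * x.2 - t * N) - x.1 * w * (w' * y.2 - t' * N)).
    by rewrite tE t'E; ring.
  by rewrite -Nx yE /qnorm /=; ring.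
rewrite -[RHS](eeD_int _ (m * j - n * k)); congr ee.
have -> : y.1 * w' = x.1 * w + k * N by rewrite -kE; ring.
rewrite ell_etaE !(rmorphD, rmorphN, rmorphM) /=.
have NR : N%:~R != 0 :> R by rewrite intr_eq0.
by field; rewrite ?lneps ?NR.
Qed.

Lemma R_summandN x : coprimez x.1 x.2 -> qnorm D x = N -> F (- x) = F x.
Proof. by move=> cx Nx; apply: R_summand_assoc => //; exact: qassocN. Qed.

(** The logarithm contributes the phase [- m / 2], and [boundary_parity] contributes [- c0 * n / 2]
    modulo [1]. *)
Lemma R_summand_boundary x (sg : int) : coprimez x.1 x.2 -> qnorm D x = N ->
  sg ^+ 2 = 1 -> N = sg * `|N| -> boundary D a0 x ->
  F x = (-1) ^ (m + c0%:Z * n).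
Proof.
move=> cx Nx sg2 NE xb; rewrite R_summandE.
have Nx0 : qnorm D x != 0 by rewrite Nx.
rewrite (ln_qratio_boundary s_gt0 s2 aZ cZ pellZ Nx0 xb) ell_etaE.
have [t tE] : exists t, invmodz N x.2 * x.2 = 1 + t * N.
  by apply: invmodzP; rewrite -Nx coprimez_qnorm.
rewrite -Nx in NE tE.
have [k [l [kE lE]]] := boundary_parity dZ aZ cZ pellZ xb NE sg2 tE.
rewrite Nx in kE lE.
rewrite -ee_half -[RHS](eeD_int _ (- m - c0%:Z * n - n * l)); congr ee.
have NR : N%:~R != 0 :> R by rewrite intr_eq0.
have e2 : 2 * (x.1 * invmodz N x.2) = N * (c0%:Z + 2 * l)
  by rewrite -lE mulrA kE mulrA.
move/(congr1 (fun z : int => z%:~R : R)): e2;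
  rewrite !(rmorphD, rmorphN, rmorphM) /=.
move: (x.1%:~R * _) => z zE.
have -> : z = N%:~R * (c0%:~R + 2 * l%:~R) / 2 by rewrite -zE; field.
by field; rewrite ?lneps ?NR.
Qed.

Lemma S_summandE g : Gamma g -> qnorm D (fst_col g) = N ->
  S_summand R D a0 c0 m n g = F (fst_col g).
Proof.
move=> g1 Ng; have cg := Gamma_coprime g1; rewrite R_summandE /S_summand.
have [-> -> -> ->] := scaled_entries R D_gt0 g.
have [t tE] : exists t, invmodz N (fst_col g).2 * (fst_col g).2 = 1 + t * N.
  by apply: invmodzP; rewrite -Ng coprimez_qnorm.
move: tE; set w := invmodz N _; rewrite /= => tE.
have k0 : Num.sqrt (2 * s) != 0 by rewrite lt0r_neq0 // sqrtr_gt0 mulr_gt0.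
have NR : N%:~R != 0 :> R by rewrite intr_eq0.
have [A0 B0] : (g 0 0)%:~R + s * (g 1 0)%:~R != 0 /\ s * (g 1 0)%:~R -
  (g 0 0)%:~R != 0.
  have Ng0 : qnorm D (fst_col g) != 0 by rewrite Ng.
  have Ng0' : qnorm D (qconj (fst_col g)) != 0 by rewrite qnorm_conj.
  have := qval_neq0 s2 Ng0; have := qval_neq0 s2 Ng0'.
  rewrite /qval /= rmorphN mulNr [_ * s]mulrC -opprB oppr_eq0 => h1 h2.
  by split.
have AB : ((g 0 0)%:~R + s * (g 1 0)%:~R) * (s * (g 1 0)%:~R - (g 0 0)%:~R) =
  - N%:~R.
  by rewrite -Ng /qnorm /= !(rmorphD, rmorphM, rmorphN) /= -s2; ring.
have ratio : `|(Num.sqrt (2 * s))^-1 * ((g 0 0)%:~R + s * (g 1 0)%:~R) /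
   ((Num.sqrt (2 * s))^-1 * (s * (g 1 0)%:~R - (g 0 0)%:~R))| = qratio s
     (fst_col g).
  rewrite /qratio /qval /= rmorphN mulNr invfM mulrACA divff ?invr_eq0 // mul1r.
  by rewrite normrM [RHS]normrM !normfV -[`|s * _ - _|]normrN opprB
    ![_ * s]mulrC.
rewrite ratio; set L := _ * ln _.
(* The phase [b / (2 * a) + d / (2 * c)] is the first two terms divided by [N]. Divisibility of the
   whole sum is checked after multiplication by [g 1 0], whose inverse modulo [N] is [w]. *)
have [k kE] : exists k, g 0 0 * g 0 1 - D%:Z * g 1 0 * g 1 1 + g 0 0 * w = k *
  N.
  set X := _ + _; exists (w * (g 1 1 + g 0 0 * t) - t * X).
  have rX : g 1 0 * X = N * (g 1 1 + g 0 0 * t).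
    transitivity (g 0 0 * (g 0 0 * g 1 1 - 1) - D%:Z * g 1 0 ^+ 2 * g 1 1
                  + g 0 0 * (1 + t * N)).
      rewrite -tE; have <- : g 0 0 * g 1 1 - g 0 1 * g 1 0 = 1
        by rewrite -det_mx2E.
      by rewrite /X; ring.
    by rewrite -Ng /qnorm /=; ring.
  transitivity (w * (g 1 0 * X) - t * N * X); last by rewrite rX; ring.
  by rewrite mulrA tE; ring.
rewrite -[RHS](eeD_int _ (n * k)); congr ee; rewrite -addrA; congr (_ + _).
rewrite !rmorphM /=.
have -> : k%:~R = ((g 0 0)%:~R * (g 0 1)%:~R - D%:Z%:~R * (g 1 0)%:~R *
  (g 1 1)%:~R
     + (g 0 0)%:~R * w%:~R) / N%:~R :> R.
  by rewrite -!(rmorphD, rmorphM, rmorphN) /= kE rmorphM /= mulfK.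
transitivity ((n%:~R : R) *
  (((g 0 0)%:~R * (g 0 1)%:~R - D%:Z%:~R * (g 1 0)%:~R * (g 1 1)%:~R) /
  N%:~R)); last first.
  by field.
congr (_ * _); rewrite -s2 -[N%:~R]opprK -AB.
by field; rewrite ?k0 ?A0 ?B0.
Qed.

(** * The reduced set, its half domain and its boundary *)

Local Notation RS := (RstarD D a0 N).

Lemma RstarP x : RS x <->
  [/\ coprimez x.1 x.2, qnorm D x = N & qsize D x <= a0%:Z * `|qnorm D x|].
Proof.
split=> -[cx Nx lex]; split=> //; first by rewrite [qnorm _ _]Nx.
by rewrite Nx in lex.
Qed.

Lemma RstarN x : RS x -> RS (- x).
Proof.
move=> /RstarP[cx Nx lex]; apply/RstarP.
rewrite (qassoc_norm (qassocN D x)); split=> //.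
  by rewrite (qassoc_coprime (qassocN D x)).
by rewrite /qsize /= !sqrrN.
Qed.

Lemma Rstar_finite : finite_set RS.
Proof.
pose B := absz (a0%:Z * `|N|).
have BE : B%:Z = a0%:Z * `|N| by rewrite gez0_abs // mulr_ge0.
pose I := (fun i : nat => i%:Z - B%:Z) @` `I_(B + B).+1.
have fI : finite_set I by apply: finite_image; exact: finite_II.
have inI (k : int) : k ^+ 2 <= B%:Z -> I k.
  move=> kB; have : - B%:Z <= k <= B%:Z by clear -kB; nia.
  move=> /andP[k1 k2]; have kB' : (absz (k + B%:Z))%:Z = k + B%:Z
    by rewrite gez0_abs //; lia.
  exists (absz (k + B%:Z)); last by rewrite kB' addrK.
  by rewrite /= -ltz_nat kB'; lia.
apply: (sub_finite_set _ (finite_setX fI fI)) => -[e g] [/= _ _].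
rewrite -BE => le1; split; apply: inI => /=.
  by apply: le_trans le1; rewrite lerDl mulr_ge0 ?sqr_ge0.
apply: le_trans le1; apply: (@le_trans _ _ (D%:Z * g ^+ 2)).
  by rewrite ler_peMl ?sqr_ge0.
by rewrite lerDr sqr_ge0.
Qed.

(* Of the boundary points [|x / x'| = eps^-1] and [|x / x'| = eps] of an orbit
   only the second is kept. *)
Definition half_domain : set (int * int) :=
  [set x | [/\ RS x, 0 < qval s x & ~ boundary D a0 x]].

Lemma double_coset_eq g h : Gamma g -> Gamma h ->
  qassoc D (fst_col g) (fst_col h) -> double_coset R D g = double_coset R D h.
Proof.
move=> g1 h1 gh; apply/seteqP; split=> k.
  move=> /(double_cosetP R D_gt0 k g1)[k1 gk];
    apply/(double_cosetP R D_gt0 k h1).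
  by split=> //; apply: qassoc_trans gk; exact: qassoc_sym.
move=> /(double_cosetP R D_gt0 k h1)[k1 gk]; apply/(double_cosetP R D_gt0 k g1).
by split=> //; apply: qassoc_trans gk.
Qed.

Lemma double_coset_self g : Gamma g -> double_coset R D g g.
Proof. by move=> g1; apply/double_cosetP => //; split=> //; exact:
  qassoc_refl. Qed.

(** Injectivity is [reduced_unique]; surjectivity applies [fundamental_domain] to the first column
    and then adjusts the sign. *)
Lemma half_domain_bij : set_bij half_domain
  [set double_coset R D g | g in [set g | Gamma g /\
     scaled R D g 0 0 * scaled R D g 1 0 = - N%:~R / (2 * s)]]
  (fun x => double_coset R D (bezout_mx x)).
Proof.
have ds : (2 * s)^-1 != 0 by rewrite invr_eq0 lt0r_neq0 // mulr_gt0.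
split.
- move=> x [/RstarP[cx Nx lex] x0 nbx]; exists (bezout_mx x) => //.
  split; first exact: bezout_mx_Gamma.
  by rewrite scaled_prod // bezout_mx_fst_col Nx.
- move=> x y /set_mem[/RstarP[cx Nx lex] x0 nbx]
  /set_mem[/RstarP[cy Ny ley] y0 nby] e.
  have := double_coset_self (bezout_mx_Gamma cy).
  rewrite -e => /(double_cosetP R D_gt0 _ (bezout_mx_Gamma cx))[_].
  rewrite !bezout_mx_fst_col => xy.
  have Nx0 : qnorm D x != 0 by rewrite Nx.
  exact: (reduced_unique s_gt0 s2 dZ aZ cZ pellZ minZ Nx0 xy).
move=> _ [g [g1 gN] <-]; have Ng : qnorm D (fst_col g) = N.
  move: gN; rewrite scaled_prod // => /(mulIf ds)/oppr_inj; exact: intr_inj.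
have [y [gy ley nby]] := fundamental_domain dZ aZ cZ pellZ (fst_col g).
have Ny : qnorm D y = N by rewrite (qassoc_norm gy).
have cy := qassoc_coprime gy (Gamma_coprime g1).
have Ry : RS y by apply/RstarP.
have y0 : qval s y != 0 by rewrite (qval_neq0 s2) // Ny.
have [z [gz Rz z0 nbz]] : exists z,
  [/\ qassoc D (fst_col g) z, RS z, 0 < qval s z
    & ~ boundary D a0 z].
  move: y0; rewrite neq_lt => /orP[y0|y0]; last by exists y.
  exists (- y); split; rewrite ?qvalN ?oppr_gt0 //.
  - by apply: qassoc_trans gy _; exact: qassocN.
  - exact: RstarN.
  - by move/boundaryN.
exists z => //; have [cz _ _] := Rz; apply: double_coset_eq => //.
  exact: bezout_mx_Gamma.
by rewrite bezout_mx_fst_col; exact: qassoc_sym.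
Qed.

Lemma S_eta_half_domain :
  S_eta_infty D a0 c0 m n (- N%:~R / (2 * s)) = \sum_(x \in half_domain) F x.
Proof.
rewrite /S_eta_infty (reindex_fsbig _ _ _ _ half_domain_bij).
apply: eq_fsbigr => x /set_mem[/RstarP[cx Nx lex] x0 nbx].
have x1 := bezout_mx_Gamma cx.
(* The chosen representative lies in its coset, so its first column is associated to [x] and gives
   the same summand. *)
have : double_coset R D (bezout_mx x)
  (xget 1%:M (double_coset R D (bezout_mx x))).
  by apply: xgetI; exact: double_coset_self.
move: (xget _ _) => h /(double_cosetP R D_gt0 h x1)[h1].
rewrite bezout_mx_fst_col => xh.
rewrite (S_summandE h1) ?(qassoc_norm xh) //.
exact: (R_summand_assoc cx Nx xh).
Qed.

(** Off the boundary, negation exchanges positive and negative [qval] and preserves the summand. *)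
Lemma Rstar_sum : \sum_(x \in RS) F x =
  \sum_(x \in RS `&` boundary D a0) F x + 2 * \sum_(x \in half_domain) F x.
Proof.
have fR := Rstar_finite.
rewrite (fsbigID (boundary D a0)) //; congr (_ + _).
rewrite (fsbigID [set x | 0 < qval s x]); last exact: finite_setIl.
rewrite mulr2n mulrDl mul1r; congr (_ + _).
  by congr (\sum_(_ \in _) _); apply/seteqP; split=>
    x /= [];[case|move=> ? ? ?]; split.
rewrite (reindex_fsbig -%R half_domain).
  apply: eq_fsbigr => x /set_mem[/RstarP[cx Nx _] _ _].
  exact: (R_summandN cx Nx).
split.
- move=> x [Rx x0 nbx]; split; last by rewrite /= qvalN oppr_gt0; apply/negP;
  rewrite -leNgt ltW.
  by split; [exact: RstarN|move/boundaryN].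
- by move=> x y _ _ /oppr_inj.
move=> x [[Rx nbx]] /= /negP; rewrite -leNgt => x0; exists (- x); last exact:
  opprK.
split; [exact: RstarN| |by move/boundaryN].
rewrite qvalN oppr_gt0 lt_neqAle x0 andbT (qval_neq0 s2) //.
by have [_ -> _] := (RstarP x).1 Rx.
Qed.

(** The sign of [N] fixes the boundary slope, on which the primitive points are [(u, - v)] and its
    negative, with equal summands. *)
Lemma boundary_sum_sign (u v sg : int) : coprimez u v -> 0 < u -> 0 < v ->
  sg ^+ 2 = 1 -> c0%:Z * u = (a0%:Z + sg) * v -> N = sg * `|N| ->
  \sum_(x \in RS `&` boundary D a0) F x =
    2 * (if N == qnorm D (u, v) then (-1) ^ (m + c0%:Z * n) else 0).
Proof.
move=> cuv u0 v0 sg2 uv NE.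
have bE x : RS x -> boundary D a0 x <->
    N = qnorm D (u, v) /\ (x = (u, - v) \/ x = (- u, v)).
  move=> /RstarP[cx Nx _]; rewrite -{1}Nx.
  by apply: (boundaryE dZ cZ pellZ cuv cx u0 v0 sg2 uv); rewrite Nx.
case: eqP => [NuvE|Nuv]; last first.
  rewrite mulr0 (_ : _ `&` _ = set0) ?fsbig_set0 //.
  by apply/seteqP; split=> x //= [/bE h /h[]].
have [bnd _ _] := slope_boundary cZ pellZ u0 v0 sg2 uv.
have Ruv : RS (u, - v).
  apply/RstarP; split; rewrite ?(qnorm_conj D (u, v)) //.
    by rewrite /= coprimezN.
  by case: bnd => ->; rewrite (qnorm_conj D (u, v)).
have set2E : RS `&` boundary D a0 = [set (u, - v); - (u, - v)].
  have nE : - (u, - v) = (- u, v) by congr pair => /=; rewrite opprK.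
  rewrite nE; apply/seteqP; split=> x /=.
    by case=> /[dup] Rx /bE h /h[_ []->]; [left|right].
  by case=> ->; split=> //; rewrite -nE; [exact: RstarN|apply/boundaryN].
have [cuv' Nuv' _] := (RstarP (u, - v)).1 Ruv.
rewrite set2E fsbigU //=; last first.
  by move=> x /= [-> []] /eqP; rewrite -subr_eq0 opprK; lia.
rewrite !fsbig_set1 (R_summandN cuv' Nuv') mulr2n mulrDl mul1r.
by rewrite (R_summand_boundary cuv' Nuv' sg2 NE bnd).
Qed.

(** As [D_minus < 0 < D_plus], the sign of [N] decides which equality in [psiD] can hold and which
    slope applies. *)
Lemma boundary_sum : \sum_(x \in RS `&` boundary D a0) F x = 2 * psiD R D a0
  c0 m n N.
Proof.
have frac (k : int) (q : rat) : 0 < k -> q = k%:~R / c0%:R ->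
    [/\ coprimez (numq q) (denq q), 0 < numq q, 0 < denq q &
        c0%:Z * numq q = k * denq q].
  move=> k0 qE; have cR : c0%:R != 0 :> rat by rewrite pnatr_eq0 -lt0n; case:
    hpell.
  split; rewrite ?denq_gt0 //.
  - by rewrite coprimezE coprime_num_den.
  - by rewrite numq_gt0 qE divr_gt0 ?ltr0z // lt0r ler0n cR.
  apply: (@intr_inj rat); rewrite !rmorphM /= numqE qE -pmulrn.
  by rewrite mulrA [c0%:R * _]mulrC divfK.
have [cp up vp ep] := frac (a0%:Z + 1) ((a0%:R + 1) / c0%:R)
  (addr_gt0 (lt_trans ltr01 aZ) ltr01) ltac:(by rewrite rmorphD).
have [cm um vm em] := frac (a0%:Z + -1) ((a0%:R - 1) / c0%:R)
  ltac:(by rewrite subr_gt0) ltac:(by rewrite rmorphD).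
have m1_sqr : (-1 : int) ^+ 2 = 1 by [].
have [_ Dp _] := slope_boundary cZ pellZ up vp (expr1n _ 2) ep.
have [_ Dm _] := slope_boundary cZ pellZ um vm m1_sqr em.
rewrite mul1r -/(D_plus D a0 c0) in Dp;
  rewrite mulN1r oppr_gt0 -/(D_minus D a0 c0) in Dm.
rewrite /psiD; have [Nneg|Npos|NE] := ltgtP N 0; last by move: N0;
  rewrite NE eqxx.
- rewrite (boundary_sum_sign cm um vm m1_sqr em).
    by rewrite (lt_eqF (lt_trans Nneg Dp)).
  by rewrite ltr0_norm // mulN1r opprK.
- rewrite (boundary_sum_sign cp up vp (expr1n _ 2) ep).
    by rewrite (gt_eqF (lt_trans Dm Npos)) orbF.
  by rewrite gtr0_norm // mul1r.
Qed.

End DoubleCosetSum.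

Theorem theorem1p3 (R : realType) (D : nat) (hD : (0 < D)%N)
  (hDsq : ~ exists k : nat, D = (k ^ 2)%N)
  (a0 c0 : nat) (hpell : pell_fundamental D a0 c0)
  (m n N : int) (hN : N != 0) :
  S_eta_infty D a0 c0 m n (- N%:~R / (2 * Num.sqrt (D%:R : R)))
  = - psiD R D a0 c0 m n N
    + 2^-1 * \sum_(eg \in RstarD D a0 N) R_summand R D a0 c0 m n N eg.
Proof.
rewrite (S_eta_half_domain R hD hpell m n hN) (Rstar_sum R hD hpell m n hN).
rewrite (boundary_sum R hD hpell m n hN) -mulrDr mulKf ?addKr //.
Qed.
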